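(* Let $R$ be a Noetherian ring with unity. The category $\mathbb{L}_R$ of all left ideals of $R$ is a preadditive category with zero object.
   Context: For a Noetherian ring $R$ with unity (not assumed commutative), $\mathbb{L}_R$ denotes the category whose objects are all left ideals of $R$ and whose morphisms $A \to B$ are all left $R$-linear maps, i.e. maps $f : A \to B$ with $f(x+y) = f(x)+f(y)$ and $f(rx) = r f(x)$ for all $x,y \in A$, $r \in R$. Composition is the usual composition of maps, and the identity morphisms are the identity maps. A category $\mathcal{C}$ is preadditive if each hom-set $\mathcal{C}(a,b)$ is an additive abelian group and composition is bilinear, i.e. $(g+g')\circ(f+f') = (g\circ f)+(g\circ f')+(g'\circ f)+(g'\circ f')$ for all $f,f' : a \to b$ and $g,g' : b \to c$. A zero object is an object that is both initial and terminal. *)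

(* Defs.v *)
From HB Require Import structures.
From mathcomp Require Import all_boot all_order all_algebra.
From mathcomp Require Import boolp classical_sets.

Set Implicit Arguments.
Unset Strict Implicit.
Unset Printing Implicit Defensive.

Import GRing.Theory.
Local Open Scope ring_scope.
Local Open Scope classical_set_scope.

Record category := Category {
  ob :> Type;
  hom : ob -> ob -> Type;
  hom_id : forall a, hom a a;
  hom_comp : forall a b c, hom b c -> hom a b -> hom a c;
  hom_comp1m : forall a b (f : hom a b), hom_comp (hom_id b) f = f;
  hom_compm1 : forall a b (f : hom a b), hom_comp f (hom_id a) = f;
  hom_compA : forall a b c d (h : hom c d) (g : hom b c) (f : hom a b),
    hom_comp h (hom_comp g f) = hom_comp (hom_comp h g) f
}.

Definition hom_zmod (C : category) (Z : forall a b : C, GRing.Zmodule (hom a b))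
  (a b : C) : zmodType := GRing.Zmodule.Pack (Z a b).

(* [GRing.Zmodule T] is the type of abelian group structures on [T]; its
   Choice component exists on every type by the classical axioms. *)
Definition preadditive (C : category) : Prop :=
  exists Z : forall a b : C, GRing.Zmodule (hom a b),
  forall (a b c : C) (f f' : hom_zmod Z a b) (g g' : hom_zmod Z b c),
    hom_comp (g + g') (f + f') =
    (hom_comp g f : hom_zmod Z a c) + hom_comp g f' + hom_comp g' f + hom_comp g' f'.

Definition initial_object (C : category) (z : C) : Prop :=
  forall a : C, exists f : hom z a, forall g : hom z a, g = f.

Definition terminal_object (C : category) (z : C) : Prop :=
  forall a : C, exists f : hom a z, forall g : hom a z, g = f.

Definition zero_object (C : category) (z : C) : Prop :=
  initial_object z /\ terminal_object z.

(* Closed under opposites, by the case r = -1 of [left_idealM]. *)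
Record left_ideal (R : pzRingType) := LeftIdeal {
  left_ideal_set :> set R;
  left_ideal0 : left_ideal_set 0;
  left_idealD : forall x y,
    left_ideal_set x -> left_ideal_set y -> left_ideal_set (x + y);
  left_idealM : forall r x, left_ideal_set x -> left_ideal_set (r * x)
}.

Definition left_noetherian (R : pzRingType) : Prop :=
  forall I : nat -> left_ideal R,
    (forall n, I n `<=` I n.+1) ->
    exists N, forall n, (N <= n)%N -> I n = I N :> set R.

(* Left and right Noetherian: a left ideal of the converse ring R^c is a right
   ideal of R. *)
Definition noetherian (R : pzRingType) : Prop :=
  left_noetherian R /\ left_noetherian R^c.

Section LeftIdealModule.
Variables (R : pzRingType) (A : left_ideal R).

(* R^o is R as a left module over itself: [r *: x] is [r * x]. *)
Definition left_ideal_elt := {x : R^o | x \in left_ideal_set A}.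

HB.instance Definition _ := [isSub of left_ideal_elt for @sval _ _].
HB.instance Definition _ := [Choice of left_ideal_elt by <:].

Fact left_ideal_submod :
  subsemimod_closed (fun x : R^o => x \in left_ideal_set A).
Proof.
split; first split.
- exact/mem_set/left_ideal0.
- move=> x y /set_mem Ax /set_mem Ay; exact/mem_set/left_idealD.
- by move=> r x /set_mem Ax; exact/mem_set/left_idealM.
Qed.

HB.instance Definition _ := GRing.SubChoice_isSubLmodule.Build R R^o
  (fun x : R^o => x \in left_ideal_set A) left_ideal_elt left_ideal_submod.

End LeftIdealModule.

Lemma linear_ext (R : pzRingType) (U V : lmodType R) (f g : {linear U -> V}) :
  f =1 g -> f = g.
Proof.
case: f g => [f [[fD] [fZ]]] [g [[gD] [gZ]]] /= /funext fg.
by subst g; rewrite (Prop_irrelevance gD fD) (Prop_irrelevance gZ fZ).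
Qed.

Section LeftIdealCategory.
Variable R : pzRingType.
Implicit Types A B C D : left_ideal R.

Definition left_ideal_hom A B : Type :=
  {linear left_ideal_elt A -> left_ideal_elt B}.

Definition left_ideal_id A : left_ideal_hom A A := idfun.

Definition left_ideal_comp A B C (g : left_ideal_hom B C)
  (f : left_ideal_hom A B) : left_ideal_hom A C := g \o f.

Fact left_ideal_comp1m A B (f : left_ideal_hom A B) :
  left_ideal_comp (left_ideal_id B) f = f.
Proof. exact: linear_ext. Qed.

Fact left_ideal_compm1 A B (f : left_ideal_hom A B) :
  left_ideal_comp f (left_ideal_id A) = f.
Proof. exact: linear_ext. Qed.

Fact left_ideal_compA A B C D (h : left_ideal_hom C D)
  (g : left_ideal_hom B C) (f : left_ideal_hom A B) :
  left_ideal_comp h (left_ideal_comp g f) =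
  left_ideal_comp (left_ideal_comp h g) f.
Proof. exact: linear_ext. Qed.

Definition left_ideal_category : category :=
  Category left_ideal_comp1m left_ideal_compm1 left_ideal_compA.

End LeftIdealCategory.

(* Main.v *)
Require Import Defs.
From HB Require Import structures.
From mathcomp Require Import all_boot all_order all_algebra.
From mathcomp Require Import boolp classical_sets.

(** Linear maps are closed under pointwise sum, opposite and zero, so each
    hom-set inherits an abelian group structure from its codomain.
    Precomposition distributes over pointwise sums by definition, and
    postcomposition by g does so because g is additive, so composition is
    bilinear.  The zero ideal is a zero object because a linear map to or from
    a module with a single element can only vanish ([linear_from_trivial] and
    [linear_to_trivial]). *)

Set Implicit Arguments.
Unset Strict Implicit.
Unset Printing Implicit Defensive.

Import GRing.Theory.
Local Open Scope ring_scope.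

Section LinearMapGroup.
Variables (R : pzRingType) (U V : lmodType R).

(** A named copy of the type of linear maps: instances are inferred from a head
    constant, and this one is the key to which the group structure is attached. *)
Definition linear_map : Type := {linear U -> V}.

Implicit Types f g h : linear_map.

Definition linear_map0 : linear_map := \0.
Definition linear_map_opp f : linear_map := \- f.
Definition linear_map_add f g : linear_map := f \+ g.

Fact linear_map_addA : associative linear_map_add.
Proof. by move=> f g h; apply: linear_ext => x /=; rewrite addrA. Qed.

Fact linear_map_addC : commutative linear_map_add.
Proof. by move=> f g; apply: linear_ext => x /=; rewrite addrC. Qed.

Fact linear_map_add0 : left_id linear_map0 linear_map_add.
Proof. by move=> f; apply: linear_ext => x /=; rewrite add0r. Qed.

Fact linear_map_addN : left_inverse linear_map0 linear_map_opp linear_map_add.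
Proof. by move=> f; apply: linear_ext => x /=; rewrite addNr. Qed.

(* A Zmodule carries a choice structure; on a type of functions it comes from
   the axiom of choice. *)
HB.instance Definition _ := gen_eqMixin linear_map.
HB.instance Definition _ := gen_choiceMixin linear_map.
HB.instance Definition _ := GRing.isZmodule.Build linear_map
  linear_map_addA linear_map_addC linear_map_add0 linear_map_addN.

End LinearMapGroup.

Lemma preadditive_left_ideal_category (R : pzRingType) :
  preadditive (left_ideal_category R).
Proof.
exists (fun A B : left_ideal R =>
  GRing.Zmodule.class (linear_map (left_ideal_elt A) (left_ideal_elt B))).
move=> A B C f f' g g'; apply: linear_ext => x.
change (g (f x + f' x) + g' (f x + f' x) =
        g (f x) + g (f' x) + g' (f x) + g' (f' x)).
by rewrite !raddfD addrA.
Qed.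

Lemma linear_from_trivial (R : pzRingType) (U V : lmodType R)
    (f : {linear U -> V}) :
  (forall x : U, x = 0) -> f = linear_map0 U V.
Proof. by move=> U0; apply: linear_ext => x; rewrite (U0 x) !raddf0. Qed.

Lemma linear_to_trivial (R : pzRingType) (U V : lmodType R)
    (f : {linear U -> V}) :
  (forall y : V, y = 0) -> f = linear_map0 U V.
Proof. by move=> V0; apply: linear_ext => x; rewrite (V0 (f x)). Qed.

Section ZeroIdeal.
Variable R : pzRingType.

Fact zero_idealD (x y : R) :
  [set 0 : R]%classic x -> [set 0 : R]%classic y -> [set 0 : R]%classic (x + y).
Proof. by move=> -> ->; rewrite /= addr0. Qed.

Fact zero_idealM (r x : R) :
  [set 0 : R]%classic x -> [set 0 : R]%classic (r * x).
Proof. by move=> ->; rewrite /= mulr0. Qed.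

Definition zero_ideal : left_ideal R :=
  LeftIdeal (erefl : [set 0 : R]%classic 0) zero_idealD zero_idealM.

Lemma zero_ideal_elt0 (x : left_ideal_elt zero_ideal) : x = 0.
Proof. by apply: val_inj; rewrite raddf0; case: x => x /= /set_mem. Qed.

Lemma zero_object_zero_ideal :
  zero_object (zero_ideal : left_ideal_category R).
Proof.
split=> A; exists (linear_map0 _ _) => f.
- exact/linear_from_trivial/zero_ideal_elt0.
- exact/linear_to_trivial/zero_ideal_elt0.
Qed.

End ZeroIdeal.

Theorem theorem3p1 (R : pzRingType) (noethR : noetherian R) :
  preadditive (left_ideal_category R) /\
  exists z : left_ideal_category R, zero_object z.
Proof.
split; first exact: preadditive_left_ideal_category.
by exists (zero_ideal R); exact: zero_object_zero_ideal.
Qed.
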